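(* For every positive integer $n$, $M(0,n)=\lfloor n/2\rfloor$.
   Context: Words are over the alphabet $\{a,b\}$. For a word $u$, $|u|$ is its length, $|u|_a$ and $|u|_b$ are the numbers of $a$'s and $b$'s in $u$, and its Parikh vector is $\mathcal{P}(u)=[|u|_a,|u|_b]$. A factor of a word is a contiguous subword. An abelian square is a word $uv$ with $|u|=|v|\ge 1$ and $\mathcal{P}(u)=\mathcal{P}(v)$. The number of abelian squares in a word $w$ is the number of distinct words that are abelian squares and occur as factors of $w$. $M(x,n)$ denotes the least number of abelian squares that can occur in a word $w$ over $\{a,b\}$ with $|w|=n$ and $|w|_a=x$. *)

(* Defs.v *)
From HB Require Import structures.
From mathcomp Require Import all_boot.

Set Implicit Arguments.
Unset Strict Implicit.
Unset Printing Implicit Defensive.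

Variant letter := la | lb.

Definition letter_is_a (c : letter) : bool := if c is la then true else false.
Definition letter_of_bool (x : bool) : letter := if x then la else lb.

Lemma letter_is_aK : cancel letter_is_a letter_of_bool.
Proof. by case. Qed.

HB.instance Definition _ := Finite.copy letter (can_type letter_is_aK).

Notation word := (seq letter).

Definition parikh (u : word) : nat * nat := (count_mem la u, count_mem lb u).

Definition abelian_square (w : word) : bool :=
  [exists i : 'I_(size w).+1,
     let u := take i w in let v := drop i w in
     [&& size u == size v, 1 <= size u & parikh u == parikh v]].

Lemma abelian_squareP (w : word) :
  reflect (exists u v : word, [/\ w = u ++ v, size u = size v, 1 <= size u
                               & parikh u = parikh v])
          (abelian_square w).
Proof.
apply: (iffP existsP) => [[i /and3P[/eqP es lu /eqP ep]]|[u [v [-> es lu ep]]]].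
  by exists (take i w), (drop i w); rewrite cat_take_drop.
have lt : size u < (size (u ++ v)).+1 by rewrite size_cat ltnS leq_addr.
exists (Ordinal lt) => /=.
by rewrite take_size_cat // drop_size_cat // es ep !eqxx -es lu.
Qed.

(* With repetitions: one entry per starting position i and length l. *)
Definition factors (w : word) : seq word :=
  [seq take l (drop i w) | i <- iota 0 (size w).+1, l <- iota 0 (size w).+1].

Lemma mem_factors (w v : word) : (v \in factors w) = infix v w.
Proof.
apply/allpairsP/infixP => [[[i l] /= [_ _ ->]]|[p [s ->]]].
  exists (take i w), (drop l (drop i w)).
  by rewrite cat_take_drop cat_take_drop.
have mem_range i : (i \in iota 0 (size (p ++ v ++ s)).+1)
                   = (i <= size p + (size v + size s)).
  by rewrite mem_iota !size_cat add0n ltnS.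
exists (size p, size v); rewrite [fst _]/= [snd _]/= !mem_range.
by rewrite leq_addr addnCA leq_addr drop_size_cat // take_size_cat.
Qed.

Definition num_abelian_squares (w : word) : nat :=
  size (undup [seq v <- factors w | abelian_square v]).

Definition attained (x n : nat) : pred nat := fun m =>
  [exists w : n.-tuple letter,
     (count_mem la w == x) && (num_abelian_squares w == m)].

Lemma ex_attained (x n : nat) : x <= n -> exists m, attained x n m.
Proof.
move=> le_xn; have sz : size (nseq x la ++ nseq (n - x) lb) == n.
  by rewrite size_cat !size_nseq subnKC.
exists (num_abelian_squares (Tuple sz)); apply/existsP; exists (Tuple sz).
by rewrite eqxx andbT /= count_cat !count_nseq mul1n mul0n addn0.
Qed.

(* The proof that x <= n guarantees that some word qualifies, so that the least
   value exists and no default is needed. *)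
Definition M (x n : nat) (le_xn : x <= n) : nat := ex_minn (ex_attained le_xn).
Arguments M : clear implicits.

(* Main.v *)
Require Import Defs.
From mathcomp Require Import all_boot.

(** A word of length [n] without [la] is a power of [lb], so the minimum runs
    over a single word.  The factors of [nseq n lb] are the powers of [lb]
    of length at most [n], and a power of [lb] is an abelian square exactly
    when its length is even and positive.  The distinct abelian squares are therefore the words
    [nseq k.*2 lb] for [1 <= k <= n./2], which [perm_lb_squares] records as an
    equality of multisets: the count is then the size of an interval. *)

Lemma count_la0_nseq (w : word) :
  count_mem la w = 0 -> w = nseq (size w) lb.
Proof. by elim: w => [//|[] w IHw] //= /IHw {1}->. Qed.

Lemma infix_nseq (T : eqType) (x : T) (n : nat) (v : seq T) :
  infix v (nseq n x) = (v == nseq (size v) x) && (size v <= n).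
Proof.
apply/idP/andP => [v_in|[/eqP-> le_vn]].
  split; last by have := size_infix v_in; rewrite size_nseq.
  apply/eqP/all_pred1P/allP => y /(mem_infix v_in).
  by rewrite mem_nseq => /andP[].
rewrite size_nseq in le_vn; rewrite -(subnKC le_vn) nseqD.
exact: prefixW (prefix_prefix _ _).
Qed.

(** Any two halves of equal length of a power of [lb] are the same word, so the
    Parikh condition is automatic and only the parity and positivity of the
    length matter. *)
Lemma abelian_square_nseq (m : nat) :
  abelian_square (nseq m lb) = (0 < m) && ~~ odd m.
Proof.
apply/abelian_squareP/andP => [[u [v [def_w eq_sz u_gt0 _]]]|[m_gt0 even_m]].
  have -> : m = (size u).*2.
    by rewrite -[LHS](size_nseq m lb) def_w size_cat -eq_sz addnn.
  by rewrite double_gt0 odd_double.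
exists (nseq m./2 lb), (nseq m./2 lb); split=> //.
  by rewrite -nseqD addnn even_halfK.
by rewrite size_nseq half_gt0; case: m m_gt0 even_m => [|[]].
Qed.

Lemma perm_lb_squares (n : nat) :
  perm_eq (undup [seq v <- factors (nseq n lb) | abelian_square v])
          [seq nseq k.*2 lb | k <- iota 1 n./2].
Proof.
apply: uniq_perm; first exact: undup_uniq.
  rewrite map_inj_uniq ?iota_uniq // => j k /(congr1 size).
  by rewrite !size_nseq => /double_inj.
move=> v; rewrite mem_undup mem_filter mem_factors infix_nseq.
apply/and3P/mapP => [[sq_v /eqP def_v le_vn]|[k]].
  move: sq_v; rewrite def_v abelian_square_nseq => /andP[v_gt0 even_v].
  exists (size v)./2; last by rewrite even_halfK.
  rewrite mem_iota add1n ltnS half_leq // andbT half_gt0.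
  by case: (size v) v_gt0 even_v => [|[]].
rewrite mem_iota add1n ltnS => /andP[k_gt0 le_k] ->.
rewrite abelian_square_nseq double_gt0 k_gt0 odd_double size_nseq eqxx.
by rewrite -geq_half_double.
Qed.

Lemma num_abelian_squares_nseq (n : nat) :
  num_abelian_squares (nseq n lb) = n./2.
Proof.
by rewrite /num_abelian_squares (perm_size (perm_lb_squares n)) size_map
           size_iota.
Qed.

Theorem theorem5 (n : nat) (n_gt0 : 0 < n) : M 0 n (leq0n n) = n./2.
Proof.
rewrite /M; case: ex_minnP => m /existsP[w /andP[/eqP w_a0 /eqP<-]] _.
by rewrite (count_la0_nseq _ w_a0) size_tuple num_abelian_squares_nseq.
Qed.
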